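(* Let $p\ge 2$ be a prime. If $f:\mathbb{Z}_p\to\mathbb{Z}_p$ is a $1$-Lipschitz map (i.e. $\|f(x)-f(y)\|_p\le\|x-y\|_p$ for all $x,y\in\mathbb{Z}_p$), then $f$ is shadowing.
   Context: $\mathbb{Z}_p$ is the ring of $p$-adic integers with the $p$-adic norm $\|\cdot\|_p$ (normalized so that $\|p\|_p=p^{-1}$) and metric $d(x,y)=\|x-y\|_p$. For a continuous map $f:X\to X$ of a metric space $(X,d)$ and $\delta>0$, a $\delta$-pseudotrajectory is a sequence $(x_n)_{n\in\mathbb{N}}$ in $X$ with $d(f(x_n),x_{n+1})\le\delta$ for all $n\in\mathbb{N}$ ($\mathbb{N}$ includes $0$). The map $f$ is shadowing (has the shadowing property) if for every $\varepsilon>0$ there is $\delta>0$ such that for every $\delta$-pseudotrajectory $(x_n)_{n\in\mathbb{N}}$ there is $x\in X$ with $d(x_n,f^n(x))\le\varepsilon$ for all $n\in\mathbb{N}$. If $f$ is a homeomorphism, ''shadowing'' means the same property with $\mathbb{N}$ replaced by $\mathbb{Z}$. *)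

(* Defs.v *)
From HB Require Import structures.
From mathcomp Require Import all_boot all_order all_algebra.
From mathcomp Require Import boolp classical_sets reals topology.

Set Implicit Arguments.
Unset Strict Implicit.
Unset Printing Implicit Defensive.

Import Order.TTheory GRing.Theory Num.Theory.

Local Open Scope ring_scope.

(* The inverse limit of the rings Z/p^n: a p-adic integer [x] is given by the
   least nonnegative residues [x n] of [x] modulo [p ^ n]; the compatibility
   condition also forces [x n < p ^ n]. *)
Record padic_int (p : nat) (p_pr : prime p) := PadicInt {
  residue :> nat -> nat;
  residue_compat : forall n, (residue n.+1 %% p ^ n)%N = residue n
}.

HB.instance Definition _ p (p_pr : prime p) := gen_eqMixin (padic_int p_pr).
HB.instance Definition _ p (p_pr : prime p) :=
  gen_choiceMixin (padic_int p_pr).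

Section PadicRing.
Local Open Scope nat_scope.
Variables (p : nat) (p_pr : prime p).
Implicit Types x y z : padic_int p_pr.

Lemma padic_eqP x y : x =1 y -> x = y.
Proof.
case: x y => [x hx] [y hy] /= /funext exy.
by rewrite exy in hx *; rewrite (Prop_irrelevance hx hy).
Qed.

Lemma residue_mod x n : x n %% p ^ n = x n.
Proof. by rewrite -(residue_compat x n) modn_mod. Qed.

Lemma residueS x n : x n.+1 = x n %[mod p ^ n].
Proof. by rewrite residue_compat residue_mod. Qed.

Lemma residue_le x m n : m <= n -> x n %% p ^ m = x m.
Proof.
move=> le_mn; rewrite -(subnKC le_mn).
elim: (n - m) => [|k IHk]; first by rewrite addn0 residue_mod.
rewrite addnS -{}IHk -[in RHS](residue_compat x (m + k)) modn_dvdm //.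
exact/dvdn_exp2l/leq_addr.
Qed.

Lemma residue_ltn x n : x n < p ^ n.
Proof. by rewrite -residue_mod ltn_mod expn_gt0 prime_gt0. Qed.

Lemma padic_of_subproof (u : nat -> nat) :
    (forall n, u n.+1 = u n %[mod p ^ n]) ->
  forall n, (u n.+1 %% p ^ n.+1) %% p ^ n = u n %% p ^ n.
Proof. by move=> hu n; rewrite modn_dvdm ?hu // dvdn_exp2l. Qed.

Definition padic_of u hu : padic_int p_pr :=
  PadicInt p_pr (@padic_of_subproof u hu).

Lemma padic_add_subproof x y n : x n.+1 + y n.+1 = x n + y n %[mod p ^ n].
Proof. by rewrite -modnDm !residueS modnDm. Qed.

Lemma padic_opp_subproof x n :
  p ^ n.+1 - x n.+1 = p ^ n - x n %[mod p ^ n].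
Proof.
apply/eqP; rewrite -(eqn_modDr (x n.+1)) subnK ?(ltnW (residue_ltn _ _)) //.
rewrite -[in X in _ == X]modnDmr residueS modnDmr.
rewrite subnK ?(ltnW (residue_ltn _ _)) //.
by rewrite modnn; apply: dvdn_exp2l.
Qed.

Lemma padic_mul_subproof x y n : x n.+1 * y n.+1 = x n * y n %[mod p ^ n].
Proof. by rewrite -modnMm !residueS modnMm. Qed.

Lemma padic_one_subproof n : 1 = 1 %[mod p ^ n]. Proof. by []. Qed.
Lemma padic_zero_subproof n : 0 = 0 %[mod p ^ n]. Proof. by []. Qed.

Definition padic_zero := padic_of padic_zero_subproof.
Definition padic_one := padic_of padic_one_subproof.
Definition padic_opp x := padic_of (padic_opp_subproof x).
Definition padic_add x y := padic_of (padic_add_subproof x y).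
Definition padic_mul x y := padic_of (padic_mul_subproof x y).

Lemma padic_addA : associative padic_add.
Proof. by move=> x y z; apply: padic_eqP => n; rewrite /= modnDml modnDmr addnA. Qed.

Lemma padic_addC : commutative padic_add.
Proof. by move=> x y; apply: padic_eqP => n; rewrite /= addnC. Qed.

Lemma padic_add0 : left_id padic_zero padic_add.
Proof. by move=> x; apply: padic_eqP => n; rewrite /= modnDml residue_mod. Qed.

Lemma padic_addN : left_inverse padic_zero padic_opp padic_add.
Proof.
move=> x; apply: padic_eqP => n.
by rewrite /= modnDml subnK ?(ltnW (residue_ltn _ _)) // modnn mod0n.
Qed.

Lemma padic_mulA : associative padic_mul.
Proof. by move=> x y z; apply: padic_eqP => n; rewrite /= modnMml modnMmr mulnA. Qed.

Lemma padic_mulC : commutative padic_mul.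
Proof. by move=> x y; apply: padic_eqP => n; rewrite /= mulnC. Qed.

Lemma padic_mul1 : left_id padic_one padic_mul.
Proof.
by move=> x; apply: padic_eqP => n; rewrite /= modnMml mul1n residue_mod.
Qed.

Lemma padic_mulD : left_distributive padic_mul padic_add.
Proof.
by move=> x y z; apply: padic_eqP => n; rewrite /= modnMml modnDm mulnDl.
Qed.

Lemma padic_one_neq0 : padic_one != padic_zero.
Proof.
apply/eqP => /(congr1 (fun x => residue x 1)) /=.
by rewrite expn1 mod0n modn_small ?prime_gt1.
Qed.

HB.instance Definition _ := GRing.isZmodule.Build (padic_int p_pr)
  padic_addA padic_addC padic_add0 padic_addN.
HB.instance Definition _ := GRing.Zmodule_isComNzRing.Build (padic_int p_pr)
  padic_mulA padic_mulC padic_mul1 padic_mulD padic_one_neq0.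

Lemma residue0 n : (0%R : padic_int p_pr) n = 0.
Proof. exact: mod0n. Qed.

Lemma residue_add x y n : (x + y)%R n = (x n + y n) %% p ^ n.
Proof. by []. Qed.

Lemma residue_sub_eq0 x y n : ((x - y)%R n == 0) = (x n == y n).
Proof.
apply/eqP/eqP => [h|h]; last first.
  rewrite /= modnDmr h subnKC ?modnn //; exact/ltnW/residue_ltn.
by rewrite -[in LHS](GRing.subrK y x) residue_add h residue_mod.
Qed.

Lemma residue_nat (k n : nat) : (k%:R%R : padic_int p_pr) n = k %% p ^ n.
Proof.
elim: k => [|k IHk]; first by rewrite residue0 mod0n.
by rewrite -addn1 natrD residue_add IHk modnDm.
Qed.

Lemma padic_neq0_ex x : x != 0%R -> exists n, x n.+1 != 0.
Proof.
move=> x_neq0; apply: contrapT => hx; case/eqP: x_neq0.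
apply: padic_eqP => -[|n]; rewrite residue0.
  by apply/eqP; rewrite -leqn0 -ltnS; exact: residue_ltn.
by apply/eqP/negP => /negP xn; apply: hx; exists n.
Qed.

End PadicRing.

Section PadicNorm.
Variables (p : nat) (p_pr : prime p).
Implicit Types x y z : padic_int p_pr.

(* The largest [n] such that [p ^ n] divides [x], for [x != 0]. *)
Definition padic_val x : nat :=
  if pselect (exists n, x n.+1 != 0%N) is left ex_n then ex_minn ex_n else 0%N.

Lemma padic_valP x n : x != 0 -> (n <= padic_val x)%N = (x n == 0%N).
Proof.
move=> /padic_neq0_ex x_neq0; rewrite /padic_val; case: pselect => // ex_n.
case: ex_minnP => v xv minv; apply/idP/eqP => [le_nv|xn0].
  have xv0 : x v = 0%N.
    case: v xv minv le_nv => [|v] _ minv _.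
      by apply/eqP; rewrite -leqn0 -ltnS; exact: residue_ltn.
    by apply/eqP/negP => /negP /minv; rewrite ltnn.
  by rewrite -(residue_le x le_nv) xv0 mod0n.
rewrite leqNgt; apply: contra xv => lt_vn.
by rewrite -(residue_le x lt_vn) xn0 mod0n.
Qed.

Variable R : realType.

Definition padic_norm x : R := if x == 0 then 0 else p%:R ^- padic_val x.

Let p_gt1 : 1 < p%:R :> R.
Proof. by rewrite ltr1n prime_gt1. Qed.

Let p_gt0 : 0 < p%:R :> R.
Proof. exact: lt_trans p_gt1. Qed.

Lemma padic_norm_ge0 x : 0 <= padic_norm x.
Proof.
by rewrite /padic_norm; case: ifP => // _; rewrite invr_ge0 exprn_ge0 // ltW.
Qed.

Lemma padic_norm_eq0 x : padic_norm x = 0 -> x = 0.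
Proof.
rewrite /padic_norm; case: eqP => // _ /eqP.
by rewrite invr_eq0 expf_eq0 gt_eqF ?andbF.
Qed.

Lemma padic_norm_le x n : (padic_norm x <= p%:R ^- n) = (x n == 0%N).
Proof.
rewrite /padic_norm; case: (eqVneq x 0) => [->|x_neq0].
  by rewrite residue0 eqxx invr_ge0 exprn_ge0 // ltW.
by rewrite lef_pV2 ?posrE ?exprn_gt0 // ler_eXn2l // padic_valP.
Qed.

Lemma padic_norm_case x : padic_norm x = 0 \/ exists n, padic_norm x = p%:R ^- n.
Proof.
rewrite /padic_norm; case: eqP => _; [by left | by right; exists (padic_val x)].
Qed.

Lemma padic_normN x : padic_norm (- x) = padic_norm x.
Proof.
have le y : padic_norm (- y) <= padic_norm y.
  case: (padic_norm_case y) => [/padic_norm_eq0 ->|[n yn]].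
    by rewrite oppr0.
  rewrite yn padic_norm_le -sub0r residue_sub_eq0 residue0 eq_sym.
  by rewrite -padic_norm_le yn.
by apply/eqP; rewrite eq_le le /= -{1}(opprK x) le.
Qed.

Lemma padic_norm_ultra x y :
  padic_norm (x + y) <= Num.max (padic_norm x) (padic_norm y).
Proof.
wlog le_yx : x y / padic_norm y <= padic_norm x => [th|].
  have /orP[/th //|/th] := le_total (padic_norm y) (padic_norm x).
  by rewrite addrC maxC.
rewrite (max_idPl le_yx).
case: (padic_norm_case x) => [x0|[n xn]].
  have /padic_norm_eq0 -> : padic_norm y = 0.
    by apply/eqP; rewrite eq_le padic_norm_ge0 andbT -x0.
  by rewrite addr0.
rewrite xn in le_yx *; rewrite padic_norm_le in le_yx.
have /eqP xn0 : x n == 0%N by rewrite -padic_norm_le xn.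
by rewrite padic_norm_le residue_add xn0 (eqP le_yx) mod0n.
Qed.

Lemma padic_norm_p : padic_norm p%:R = p%:R^-1.
Proof.
have r2 : (p%:R : padic_int p_pr) 2 = p.
  by rewrite residue_nat modn_small // ltn_Pmulr ?prime_gt1 ?prime_gt0.
have p_neq0 : p != 0%N by rewrite -lt0n prime_gt0.
have pp_neq0 : (p%:R : padic_int p_pr) != 0.
  by apply: contra_neq p_neq0 => p0; rewrite -r2 p0 residue0.
suff -> : padic_norm p%:R = p%:R ^- 1 by rewrite expr1.
rewrite /padic_norm (negPf pp_neq0); suff /eqP -> : padic_val p%:R == 1%N by [].
rewrite eqn_leq padic_valP // residue_nat expn1 modnn eqxx andbT.
by rewrite leqNgt padic_valP // r2.
Qed.

End PadicNorm.

Section PadicTopology.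
Local Open Scope classical_set_scope.
Local Open Scope relation_scope.
Variables (p : nat) (p_pr : prime p).
Local Notation Zp := (padic_int p_pr).

(* The uniformity is given by the congruences modulo [p ^ n], so that it does
   not depend on the field in which the norm takes its values. *)
Definition padic_ent : set_system (Zp * Zp) :=
  filter_from setT (fun n : nat => [set xy : Zp * Zp | xy.1 n = xy.2 n]).

Lemma padic_ent_filter : Filter padic_ent.
Proof.
apply: filter_from_filter; first by exists 0%N.
move=> m n _ _; exists (maxn m n) => // -[x y] /= exy; split => /=.
  by rewrite -!(residue_le _ (leq_maxl m n)) exy.
by rewrite -!(residue_le _ (leq_maxr m n)) exy.
Qed.

Lemma padic_ent_diagonal A : padic_ent A -> diagonal `<=` A.
Proof. by move=> [n _ sA] -[x y] exy; apply: sA; rewrite /= (exy : x = y). Qed.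

Lemma padic_ent_inv A : padic_ent A -> padic_ent A^-1.
Proof. by move=> [n _ sA]; exists n => // -[x y] /= exy; apply: sA. Qed.

Lemma padic_ent_split A :
  padic_ent A -> exists2 B, padic_ent B & B \; B `<=` A.
Proof.
move=> [n _ sA]; exists [set xy : Zp * Zp | xy.1 n = xy.2 n]; first by exists n.
by move=> [x z] [y /= xy yz]; apply: sA; rewrite /= xy.
Qed.

HB.instance Definition _ := isUniform.Build Zp
  padic_ent_filter padic_ent_diagonal padic_ent_inv padic_ent_split.

Variable R : realType.

Definition padic_dist (x y : Zp) : R := padic_norm R (x - y).

Definition padic_ball (x : Zp) (e : R) : set Zp := [set y | padic_dist x y < e].

Lemma padic_dist_sym x y : padic_dist x y = padic_dist y x.
Proof. by rewrite /padic_dist -padic_normN opprB. Qed.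

Lemma padic_ball_center x (e : R) : 0 < e -> padic_ball x e x.
Proof. by rewrite /padic_ball /= /padic_dist subrr /padic_norm eqxx. Qed.

Lemma padic_ball_sym x y (e : R) : padic_ball x e y -> padic_ball y e x.
Proof. by rewrite /padic_ball /= padic_dist_sym. Qed.

Lemma padic_ball_triangle x y z (e1 e2 : R) :
  padic_ball x e1 y -> padic_ball y e2 z -> padic_ball x (e1 + e2) z.
Proof.
rewrite /padic_ball /= => xy yz; rewrite /padic_dist.
have -> : x - z = (x - y) + (y - z) by rewrite addrA subrK.
apply: le_lt_trans (ltrD xy yz); apply: le_trans (padic_norm_ultra _ _ _) _.
by rewrite ge_max lerDl lerDr !padic_norm_ge0.
Qed.

Lemma padic_entE : entourage = entourage_ padic_ball.
Proof.
have p_gt1 : 1 < p%:R :> R by rewrite ltr1n prime_gt1.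
have p_gt0 : 0 < p%:R :> R by apply: lt_trans p_gt1.
apply/seteqP; split => A [].
  move=> n _ sA; exists (p%:R ^- n); first by rewrite /= invr_gt0 exprn_gt0.
  move=> [x y] /= /ltW; rewrite padic_norm_le residue_sub_eq0 => /eqP exy.
  exact: sA.
move=> e /= e_gt0 sA; pose n := (Num.truncn e^-1).+1.
exists n => // -[x y] /= exy; apply: sA => /=.
have : padic_dist x y <= p%:R ^- n.
  by rewrite padic_norm_le residue_sub_eq0 exy.
move=> /le_lt_trans; apply; rewrite -[ltRHS]invrK ltf_pV2 ?posrE ?invr_gt0 //.
  apply: lt_le_trans (truncnS_gt _) _.
  by rewrite -/n -natrX ler_nat ltnW // ltn_expl // prime_gt1.
exact: exprn_gt0.
Qed.

HB.instance Definition _ := Uniform_isPseudoMetric.Build R Zp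
  padic_ball_center padic_ball_sym padic_ball_triangle padic_entE.

Lemma padic_dist_ge0 x y : 0 <= padic_dist x y.
Proof. exact: padic_norm_ge0. Qed.

Lemma padic_dist_positivity x y : padic_dist x y = 0 -> x = y.
Proof. by move/padic_norm_eq0/eqP; rewrite subr_eq0 => /eqP. Qed.

Lemma padic_ballE x (d : R) : ball x d = [set y | padic_dist x y < d].
Proof. by []. Qed.

HB.instance Definition _ := PseudoMetric_isMetric.Build R Zp
  padic_dist_ge0 padic_dist_positivity padic_ballE.

Lemma padic_mdistE (x y : Zp) : mdist x y = padic_norm R (x - y).
Proof. by []. Qed.

End PadicTopology.

Section Shadowing.
Variables (R : realType) (X : metricType R).
Implicit Types (f g : X -> X) (d e : R).

Definition pseudotrajectory f d (x : nat -> X) :=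
  forall n : nat, mdist (f (x n)) (x n.+1) <= d.

Definition shadowing_nat f :=
  forall e, 0 < e -> exists2 d, 0 < d &
    forall x : nat -> X, pseudotrajectory f d x ->
    exists y : X, forall n : nat, mdist (x n) (iter n f y) <= e.

Definition homeomorphism f g :=
  [/\ continuous f, continuous g, cancel f g & cancel g f].

(* The iterates [f^n] for [n : int] when [g] is the inverse of [f]; recall
   that [Negz k] stands for [- k.+1]. *)
Definition iterz f g (n : int) (x : X) : X :=
  match n with Posz k => iter k f x | Negz k => iter k.+1 g x end.

Definition pseudotrajectoryz f d (x : int -> X) :=
  forall n : int, mdist (f (x n)) (x (n + 1)) <= d.

Definition shadowing_int f g :=
  forall e, 0 < e -> exists2 d, 0 < d &
    forall x : int -> X, pseudotrajectoryz f d x ->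
    exists y : X, forall n : int, mdist (x n) (iterz f g n y) <= e.

(* A homeomorphism is required to satisfy the two-sided property; requiring
   the one-sided property of all maps adds nothing, see
   [shadowing_int_nat]. *)
Definition shadowing f :=
  shadowing_nat f /\ forall g, homeomorphism f g -> shadowing_int f g.

Lemma shadowing_int_nat f g :
  homeomorphism f g -> shadowing_int f g -> shadowing_nat f.
Proof.
move=> [_ _ _ gK] sh e /sh [d d_gt0 {}sh]; exists d => // x x_pt.
pose z (n : int) := if n is Posz k then x k else iterz f g n (x 0%N).
have [|y hy] := sh z; last by exists y => n; exact: (hy n).
move=> [n|[|n]].
- have -> : n%:Z + 1 = n.+1 by rewrite -addn1 PoszD.
  exact: x_pt.
- by rewrite (_ : Negz 0 + 1 = 0) //= gK mdistxx ltW.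
- rewrite (_ : Negz n.+1 + 1 = Negz n); last by rewrite !NegzE -addn1 PoszD opprD subrK.
  by rewrite /= gK mdistxx ltW.
Qed.

End Shadowing.

(* Main.v *)
(* At scale p^-n, a 1-Lipschitz map is a self-map of the finite set Z/p^n, where
   a p^-n-pseudotrajectory is an exact orbit: the orbit of [x 0] shadows it.
   When f is bijective, the induced map on Z/p^n is surjective, hence injective,
   so the argument also runs backwards in time. *)
Require Import Defs.
From mathcomp Require Import all_boot all_order all_algebra.
From mathcomp Require Import reals topology.

Import Order.TTheory GRing.Theory Num.Theory.

Local Open Scope ring_scope.

Lemma expN_le_ex (R : realType) (p : nat) (e : R) :
  (1 < p)%N -> 0 < e -> exists n : nat, p%:R ^- n <= e.
Proof.
(* This [n] exceeds [e^-1], and [n < p ^ n]. *)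
move=> p_gt1 e_gt0; exists (Num.truncn e^-1).+1.
rewrite -[leRHS]invrK lef_pV2 ?posrE ?invr_gt0 ?exprn_gt0 ?ltr0n 1?ltnW //.
apply: ltW; apply: lt_le_trans (truncnS_gt _) _.
by rewrite -natrX ler_nat ltnW // ltn_expl.
Qed.

(** Turns both the pseudotrajectory bound and the shadowing bound, at scale [p^-n], into equalities
    of residues. *)
Lemma padic_mdist_le (R : realType) (p : nat) (p_pr : prime p)
    (x y : padic_int p_pr) (n : nat) :
  (mdist x y <= p%:R ^- n :> R) = (x n == y n).
Proof. by rewrite padic_mdistE padic_norm_le residue_sub_eq0. Qed.

Lemma lipschitz_residue (R : realType) (p : nat) (p_pr : prime p)
    (f : padic_int p_pr -> padic_int p_pr)
    (f_lip : forall x y, padic_norm R (f x - f y) <= padic_norm R (x - y))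
    (n : nat) (x y : padic_int p_pr) :
  x n = y n -> f x n = f y n.
Proof.
move=> /eqP; rewrite -(padic_mdist_le R) padic_mdistE => xy.
apply/eqP; rewrite -(padic_mdist_le R) padic_mdistE.
exact: le_trans (f_lip x y) xy.
Qed.

(** Since [g] may fail to preserve congruences, it is only evaluated on chosen representatives
    [lift i]. This still gives a right inverse of the map that [f] induces on ['I_(p ^ n)], and on a
    finite type a right inverse is two-sided. *)
Lemma residue_inj_of_section (p : nat) (p_pr : prime p)
    (f g : padic_int p_pr -> padic_int p_pr) (n : nat)
    (f_res : forall x y : padic_int p_pr, x n = y n -> f x n = f y n)
    (gK : cancel g f) (x y : padic_int p_pr) :
  f x n = f y n -> x n = y n.
Proof.
pose lift (i : 'I_(p ^ n)) : padic_int p_pr := (i : nat)%:R.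
pose red (z : padic_int p_pr) : 'I_(p ^ n) := Ordinal (residue_ltn z n).
have liftE z : lift (red z) n = z n by rewrite residue_nat residue_mod.
have GF : cancel (fun i => red (g (lift i))) (fun i => red (f (lift i))).
  move=> i; apply: val_inj => /=.
  by rewrite (f_res _ _ (liftE _)) gK residue_nat modn_small.
move=> fxy; have : red x = red y; last by move=> /(congr1 val).
apply: (can_inj (canF_sym GF)); apply: val_inj => /=.
by rewrite !(f_res _ _ (liftE _)).
Qed.

Theorem proposition18 (R : realType) (p : nat) (p_pr : prime p)
    (f : padic_int p_pr -> padic_int p_pr)
    (f_lip : forall x y : padic_int p_pr,
       padic_norm R (f x - f y) <= padic_norm R (x - y)) :
  @shadowing R (padic_int p_pr) f.
Proof.
have p_gt0 : 0 < p%:R :> R by rewrite ltr0n prime_gt0.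
have f_res := lipschitz_residue R p p_pr f f_lip.
split=> [|g [_ _ _ gK]] e e_gt0;
  (* Both cases take [p^-n <= e] as the tolerance: congruences mod [p ^ n] pass through [f] intact,
     so errors do not accumulate. *)
  have [n n_e] := expN_le_ex R p e (prime_gt1 p_pr) e_gt0;
  exists (p%:R ^- n); rewrite ?invr_gt0 ?exprn_gt0 // => x x_pt.
- have xS k : f (x k) n = x k.+1 n.
    by apply/eqP; rewrite -(padic_mdist_le R); apply: x_pt.
  exists (x 0%N) => k; apply: le_trans n_e; rewrite padic_mdist_le; apply/eqP.
  by elim: k => [//|k IHk]; rewrite -xS; apply: f_res.
- have xS k : f (x k) n = x (k + 1) n.
    by apply/eqP; rewrite -(padic_mdist_le R); apply: x_pt.
  exists (x 0) => k; apply: le_trans n_e; rewrite padic_mdist_le; apply/eqP.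
  have xpos (i : nat) : x i n = iter i f (x 0) n.
    by elim: i => [//|i IHi]; rewrite -addn1 PoszD -xS addn1; apply: f_res.
  have xneg (i : nat) : x (- i%:Z) n = iter i g (x 0) n.
    elim: i => [|i IHi]; first by rewrite oppr0.
    (* It suffices to compare the images under [f], which lie one step closer to time 0, where [IHi]
       applies. *)
    apply: (residue_inj_of_section _ _ f g _ (f_res n) gK).
    by rewrite xS iterS gK -addn1 PoszD opprD subrK.
  by case: k => i; [apply: xpos | rewrite NegzE; apply: xneg].
Qed.
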